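(* Let $R$ be an integral domain containing $\mathbb{Z}$ as a subring, let $n,m\geqslant 3$, and let $X=\{x_1,\dots,x_n\}$ and $Y=\{y_1,\dots,y_m\}$ be sets with $n$ and $m$ elements respectively. Let $C_n$ be the cycle of length $n$ with vertex set $X$ and $C_m$ the cycle of length $m$ with vertex set $Y$. Then the partially commutative metabelian Lie $R$-algebras $M(X;C_n)$ and $M(Y;C_m)$ are universally equivalent if and only if $m=n$.
   Context: For a finite undirected graph $G$ without loops and with vertex set $X$, the partially commutative metabelian Lie $R$-algebra $M(X;G)$ is the quotient of the free metabelian Lie $R$-algebra on the generating set $X$ by the ideal generated by all $[x,y]$ with $\{x,y\}$ an edge of $G$. (Metabelian: $[[a,b],[c,d]]=0$ for all $a,b,c,d$.) Two Lie algebras are universally equivalent if they satisfy the same universal sentences, i.e. sentences without free variables of the form $\forall w_1\dots w_k\,\Phi(w_1,\dots,w_k)$ with $\Phi$ quantifier-free, in the first-order language with equality, addition $+$, Lie bracket $[\cdot,\cdot]$ and $0$ (equivalently, if they satisfy the same existential sentences). *)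

(* Defs.v *)
From HB Require Import structures.
From mathcomp Require Import all_boot all_order all_algebra.
From mathcomp Require Import boolp.

Set Implicit Arguments.
Unset Strict Implicit.
Unset Printing Implicit Defensive.

Import GRing.Theory.
Local Open Scope ring_scope.
Local Open Scope quotient_scope.

HB.mixin Record Lmodule_isLieAlg (R : comNzRingType) L of GRing.Lmodule R L := {
  bracket : L -> L -> L;
  bracketDl : forall x y z, bracket (x + y) z = bracket x z + bracket y z;
  bracketDr : forall x y z, bracket x (y + z) = bracket x y + bracket x z;
  bracketZl : forall (a : R) x y, bracket (a *: x) y = a *: bracket x y;
  bracketZr : forall (a : R) x y, bracket x (a *: y) = a *: bracket x y;
  bracketxx : forall x, bracket x x = 0;
  bracketJ : forall x y z,
    bracket x (bracket y z) + bracket y (bracket z x)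
      + bracket z (bracket x y) = 0
}.

#[short(type="lieAlgType")]
HB.structure Definition LieAlg (R : comNzRingType) :=
  { L of GRing.Lmodule R L & Lmodule_isLieAlg R L }.

Section Ideal.
Variables (R : comNzRingType) (L : lieAlgType R).

(* Two-sidedness is automatic, by antisymmetry of the bracket. *)
Definition lie_ideal (I : L -> Prop) : Prop :=
  [/\ I 0,
      forall x y, I x -> I y -> I (x + y),
      forall (a : R) x, I x -> I (a *: x)
    & forall x y, I y -> I (bracket x y)].

Definition ideal_gen (S : L -> Prop) (x : L) : Prop :=
  forall I : L -> Prop, lie_ideal I -> (forall y, S y -> I y) -> I x.

Lemma ideal_gen_ideal (S : L -> Prop) : lie_ideal (ideal_gen S).
Proof.
split=> [|x y Sx Sy|a x Sx|x y Sy] I HI SI; have [I0 ID IZ IB] := HI => //.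
- by apply: ID; [apply: Sx | apply: Sy].
- by apply: IZ; apply: Sx.
- by apply: IB; apply: Sy.
Qed.

Lemma bracketC (x y : L) : bracket x y = - bracket y x.
Proof.
apply/eqP; rewrite -addr_eq0; apply/eqP.
have := bracketxx (x + y).
by rewrite bracketDl !bracketDr !bracketxx add0r addr0.
Qed.

Lemma bracketNl (x y : L) : bracket (- x) y = - bracket x y.
Proof. by rewrite -scaleN1r bracketZl scaleN1r. Qed.

Lemma bracketNr (x y : L) : bracket x (- y) = - bracket x y.
Proof. by rewrite -scaleN1r bracketZr scaleN1r. Qed.

Definition ideal_pred (S : L -> Prop) : {pred L} := fun x => `[< ideal_gen S x >].

Lemma ideal_pred_zmod (S : L -> Prop) : zmod_closed (ideal_pred S).
Proof.
have [I0 ID IZ _] := ideal_gen_ideal S.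
split=> [|x y]; first by apply/asboolP.
move=> /asboolP Sx /asboolP Sy; apply/asboolP.
by apply: ID => //; rewrite -scaleN1r; apply: IZ.
Qed.

HB.instance Definition _ (S : L -> Prop) :=
  GRing.isZmodClosed.Build L (ideal_pred S) (ideal_pred_zmod S).

End Ideal.

Section LieQuotient.
Variables (R : comNzRingType) (L : lieAlgType R) (S : L -> Prop).

Definition lie_quot : Type := Quotient.quot (ideal_pred S).

HB.instance Definition _ := GRing.Zmodule.on lie_quot.

Definition lie_pi (x : L) : lie_quot :=
  \pi_(Quotient.quot (ideal_pred S)) x.

Definition lie_rep (u : lie_quot) : L :=
  repr (u : Quotient.quot (ideal_pred S)).

Lemma lie_repK u : lie_pi (lie_rep u) = u.
Proof. exact: reprK. Qed.

Lemma lie_piP x y : lie_pi x = lie_pi y <-> ideal_gen S (x - y).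
Proof.
split=> [/eqP|Sxy].
  by rewrite -Quotient.idealrBE => /asboolP.
by apply/eqP; rewrite -Quotient.idealrBE; apply/asboolP.
Qed.

Lemma lie_piD x y : lie_pi (x + y) = lie_pi x + lie_pi y.
Proof. exact: Quotient.pi_add. Qed.

Definition quot_scale (a : R) (u : lie_quot) : lie_quot :=
  lie_pi (a *: lie_rep u).

Definition quot_bracket (u v : lie_quot) : lie_quot :=
  lie_pi (bracket (lie_rep u) (lie_rep v)).

Lemma lie_pi_scale a x : quot_scale a (lie_pi x) = lie_pi (a *: x).
Proof.
have [_ _ IZ _] := ideal_gen_ideal S.
apply/lie_piP; rewrite -scalerBr; apply: IZ; apply/lie_piP.
exact: lie_repK.
Qed.

Lemma lie_pi_bracket x y :
  quot_bracket (lie_pi x) (lie_pi y) = lie_pi (bracket x y).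
Proof.
have [_ ID IZ IB] := ideal_gen_ideal S.
apply/lie_piP; set x' := lie_rep _; set y' := lie_rep _.
have -> : bracket x' y' - bracket x y
    = bracket x' (y' - y) + (-1) *: bracket y (x' - x).
  rewrite scaleN1r -(bracketC (x' - x) y) bracketDr bracketDl bracketNr bracketNl.
  by rewrite addrA addrNK.
apply: ID; last apply: IZ; apply: IB; apply/lie_piP; exact: lie_repK.
Qed.

Fact quot_scaleA a b u : quot_scale a (quot_scale b u) = quot_scale (a * b) u.
Proof. by rewrite -[u]lie_repK !lie_pi_scale scalerA. Qed.

Fact quot_scale1 : left_id 1 quot_scale.
Proof. by move=> u; rewrite -[u]lie_repK lie_pi_scale scale1r. Qed.

Fact quot_scaleDr : right_distributive quot_scale +%R.
Proof.
move=> a u v; rewrite -[u]lie_repK -[v]lie_repK.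
by rewrite -lie_piD !lie_pi_scale -lie_piD scalerDr.
Qed.

Fact quot_scaleDl u : {morph quot_scale^~ u : a b / a + b}.
Proof.
move=> a b; rewrite -[u]lie_repK /=.
by rewrite !lie_pi_scale -lie_piD scalerDl.
Qed.

HB.instance Definition _ := GRing.Zmodule_isLmodule.Build R lie_quot
  quot_scaleA quot_scale1 quot_scaleDr quot_scaleDl.

Lemma lie_piZ a x : lie_pi (a *: x) = a *: lie_pi x.
Proof. by rewrite -lie_pi_scale. Qed.

Fact quot_bracketDl u v w :
  quot_bracket (u + v) w = quot_bracket u w + quot_bracket v w.
Proof.
rewrite -[u]lie_repK -[v]lie_repK -[w]lie_repK.
by rewrite -lie_piD !lie_pi_bracket -lie_piD bracketDl.
Qed.

Fact quot_bracketDr u v w :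
  quot_bracket u (v + w) = quot_bracket u v + quot_bracket u w.
Proof.
rewrite -[u]lie_repK -[v]lie_repK -[w]lie_repK.
by rewrite -lie_piD !lie_pi_bracket -lie_piD bracketDr.
Qed.

Fact quot_bracketZl a u v : quot_bracket (a *: u) v = a *: quot_bracket u v.
Proof.
rewrite -[u]lie_repK -[v]lie_repK.
by rewrite -lie_piZ !lie_pi_bracket -lie_piZ bracketZl.
Qed.

Fact quot_bracketZr a u v : quot_bracket u (a *: v) = a *: quot_bracket u v.
Proof.
rewrite -[u]lie_repK -[v]lie_repK.
by rewrite -lie_piZ !lie_pi_bracket -lie_piZ bracketZr.
Qed.

Fact lie_pi0 : lie_pi 0 = 0.
Proof. by rewrite -[0 in LHS](scale0r 0) lie_piZ scale0r. Qed.

Fact quot_bracketxx u : quot_bracket u u = 0.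
Proof. by rewrite -[u]lie_repK lie_pi_bracket bracketxx lie_pi0. Qed.

Fact quot_bracketJ u v w :
  quot_bracket u (quot_bracket v w) + quot_bracket v (quot_bracket w u)
    + quot_bracket w (quot_bracket u v) = 0.
Proof.
rewrite -[u]lie_repK -[v]lie_repK -[w]lie_repK.
by rewrite !lie_pi_bracket -!lie_piD bracketJ lie_pi0.
Qed.

HB.instance Definition _ := Lmodule_isLieAlg.Build R lie_quot
  quot_bracketDl quot_bracketDr quot_bracketZl quot_bracketZr
  quot_bracketxx quot_bracketJ.

Lemma lie_piB x y : lie_pi (bracket x y) = bracket (lie_pi x) (lie_pi y).
Proof. by rewrite -lie_pi_bracket. Qed.

End LieQuotient.

(* Formal Lie expressions in the generators, modulo the least congruence that
   enforces the axioms of Lie [R]-algebras. *)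
Inductive lie_expr (R X : Type) : Type :=
| LGen of X
| LZero
| LAdd of lie_expr R X & lie_expr R X
| LOpp of lie_expr R X
| LScale of R & lie_expr R X
| LBracket of lie_expr R X & lie_expr R X.

Arguments LGen {R X}.
Arguments LZero {R X}.

HB.instance Definition _ (R X : Type) := gen_eqMixin (lie_expr R X).
HB.instance Definition _ (R X : Type) := gen_choiceMixin (lie_expr R X).

Section FreeLie.
Variables (R : comNzRingType) (X : Type).
Local Notation expr := (lie_expr R X).

Inductive lie_congr : expr -> expr -> Prop :=
| LC_refl s : lie_congr s s
| LC_sym s t : lie_congr s t -> lie_congr t s
| LC_trans s t u : lie_congr s t -> lie_congr t u -> lie_congr s u
| LC_add s s' t t' : lie_congr s s' -> lie_congr t t' ->
    lie_congr (LAdd s t) (LAdd s' t')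
| LC_opp s s' : lie_congr s s' -> lie_congr (LOpp s) (LOpp s')
| LC_scale a s s' : lie_congr s s' -> lie_congr (LScale a s) (LScale a s')
| LC_bracket s s' t t' : lie_congr s s' -> lie_congr t t' ->
    lie_congr (LBracket s t) (LBracket s' t')
| LC_addA s t u : lie_congr (LAdd s (LAdd t u)) (LAdd (LAdd s t) u)
| LC_addC s t : lie_congr (LAdd s t) (LAdd t s)
| LC_add0 s : lie_congr (LAdd LZero s) s
| LC_addN s : lie_congr (LAdd (LOpp s) s) LZero
| LC_scaleA a b s : lie_congr (LScale a (LScale b s)) (LScale (a * b) s)
| LC_scale1 s : lie_congr (LScale 1 s) s
| LC_scaleDr a s t :
    lie_congr (LScale a (LAdd s t)) (LAdd (LScale a s) (LScale a t))
| LC_scaleDl a b s :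
    lie_congr (LScale (a + b) s) (LAdd (LScale a s) (LScale b s))
| LC_bracketDl s t u :
    lie_congr (LBracket (LAdd s t) u) (LAdd (LBracket s u) (LBracket t u))
| LC_bracketDr s t u :
    lie_congr (LBracket s (LAdd t u)) (LAdd (LBracket s t) (LBracket s u))
| LC_bracketZl a s t :
    lie_congr (LBracket (LScale a s) t) (LScale a (LBracket s t))
| LC_bracketZr a s t :
    lie_congr (LBracket s (LScale a t)) (LScale a (LBracket s t))
| LC_bracketxx s : lie_congr (LBracket s s) LZero
| LC_bracketJ s t u :
    lie_congr (LAdd (LAdd (LBracket s (LBracket t u))
                          (LBracket t (LBracket u s)))
                    (LBracket u (LBracket s t))) LZero.

Definition lie_congrb (s t : expr) : bool := `[< lie_congr s t >].

Fact lie_congrb_equiv : equiv_class_of lie_congrb.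
Proof.
split=> [s|s t|t s u].
- by apply/asboolP; apply: LC_refl.
- by apply/asboolP/asboolP; apply: LC_sym.
- by move=> /asboolP st /asboolP tu; apply/asboolP; apply: LC_trans tu.
Qed.

Canonical lie_congrb_equivRel := EquivRelPack lie_congrb_equiv.
Canonical lie_congrb_encModRel := defaultEncModRel lie_congrb.

Definition free_lie : Type := {eq_quot lie_congrb}.

HB.instance Definition _ := Choice.on free_lie.

Definition free_pi (s : expr) : free_lie := \pi_({eq_quot lie_congrb}) s.

Definition free_rep (u : free_lie) : expr :=
  repr (u : {eq_quot lie_congrb}).

Lemma free_repK u : free_pi (free_rep u) = u.
Proof. exact: reprK. Qed.

Lemma free_piP s t : free_pi s = free_pi t <-> lie_congr s t.
Proof.
split=> [/eqquotP /asboolP //|st].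
by apply/eqquotP; apply/asboolP.
Qed.

Lemma free_rep_pi s : lie_congr (free_rep (free_pi s)) s.
Proof. by apply/free_piP; apply: free_repK. Qed.

Definition free_add (u v : free_lie) := free_pi (LAdd (free_rep u) (free_rep v)).
Definition free_opp (u : free_lie) := free_pi (LOpp (free_rep u)).
Definition free_scale a (u : free_lie) := free_pi (LScale a (free_rep u)).
Definition free_bracket (u v : free_lie) :=
  free_pi (LBracket (free_rep u) (free_rep v)).

Lemma free_piD s t : free_add (free_pi s) (free_pi t) = free_pi (LAdd s t).
Proof. by apply/free_piP; apply: LC_add; apply: free_rep_pi. Qed.

Lemma free_piN s : free_opp (free_pi s) = free_pi (LOpp s).
Proof. by apply/free_piP; apply: LC_opp; apply: free_rep_pi. Qed.

Lemma free_piZ a s : free_scale a (free_pi s) = free_pi (LScale a s).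
Proof. by apply/free_piP; apply: LC_scale; apply: free_rep_pi. Qed.

Lemma free_piB s t :
  free_bracket (free_pi s) (free_pi t) = free_pi (LBracket s t).
Proof. by apply/free_piP; apply: LC_bracket; apply: free_rep_pi. Qed.

Let freeE := (free_piD, free_piN, free_piZ, free_piB).

Fact free_addA : associative free_add.
Proof.
move=> u v w; rewrite -[u]free_repK -[v]free_repK -[w]free_repK !freeE.
by apply/free_piP; constructor.
Qed.

Fact free_addC : commutative free_add.
Proof.
move=> u v; rewrite -[u]free_repK -[v]free_repK !freeE.
by apply/free_piP; apply: LC_addC.
Qed.

Fact free_add0 : left_id (free_pi LZero) free_add.
Proof.
move=> u; rewrite -[u]free_repK !freeE.
by apply/free_piP; apply: LC_add0.
Qed.

Fact free_addN : left_inverse (free_pi LZero) free_opp free_add.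
Proof.
move=> u; rewrite -[u]free_repK !freeE.
by apply/free_piP; apply: LC_addN.
Qed.

HB.instance Definition _ :=
  GRing.isZmodule.Build free_lie free_addA free_addC free_add0 free_addN.

Fact free_scaleA a b u : free_scale a (free_scale b u) = free_scale (a * b) u.
Proof.
rewrite -[u]free_repK !freeE.
by apply/free_piP; apply: LC_scaleA.
Qed.

Fact free_scale1 : left_id 1 free_scale.
Proof.
move=> u; rewrite -[u]free_repK !freeE.
by apply/free_piP; apply: LC_scale1.
Qed.

Fact free_scaleDr : right_distributive free_scale +%R.
Proof.
move=> a u v; rewrite -[u]free_repK -[v]free_repK /GRing.add /= !freeE.
by apply/free_piP; apply: LC_scaleDr.
Qed.

Fact free_scaleDl u : {morph free_scale^~ u : a b / a + b}.
Proof.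
move=> a b; rewrite -[u]free_repK [RHS]/GRing.add /= !freeE.
by apply/free_piP; apply: LC_scaleDl.
Qed.

HB.instance Definition _ := GRing.Zmodule_isLmodule.Build R free_lie
  free_scaleA free_scale1 free_scaleDr free_scaleDl.

Fact free_bracketDl u v w :
  free_bracket (u + v) w = free_bracket u w + free_bracket v w.
Proof.
rewrite -[u]free_repK -[v]free_repK -[w]free_repK /GRing.add /= !freeE.
by apply/free_piP; apply: LC_bracketDl.
Qed.

Fact free_bracketDr u v w :
  free_bracket u (v + w) = free_bracket u v + free_bracket u w.
Proof.
rewrite -[u]free_repK -[v]free_repK -[w]free_repK /GRing.add /= !freeE.
by apply/free_piP; apply: LC_bracketDr.
Qed.

Fact free_bracketZl (a : R) (u v : free_lie) :
  free_bracket (a *: u) v = a *: free_bracket u v.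
Proof.
rewrite -[u]free_repK -[v]free_repK /GRing.scale /= !freeE.
by apply/free_piP; apply: LC_bracketZl.
Qed.

Fact free_bracketZr (a : R) (u v : free_lie) :
  free_bracket u (a *: v) = a *: free_bracket u v.
Proof.
rewrite -[u]free_repK -[v]free_repK /GRing.scale /= !freeE.
by apply/free_piP; apply: LC_bracketZr.
Qed.

Fact free_bracketxx u : free_bracket u u = 0.
Proof.
rewrite -[u]free_repK !freeE.
by apply/free_piP; apply: LC_bracketxx.
Qed.

Fact free_bracketJ u v w :
  free_bracket u (free_bracket v w) + free_bracket v (free_bracket w u)
    + free_bracket w (free_bracket u v) = 0.
Proof.
rewrite -[u]free_repK -[v]free_repK -[w]free_repK /GRing.add /= !freeE.
by apply/free_piP; apply: LC_bracketJ.
Qed.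

HB.instance Definition _ := Lmodule_isLieAlg.Build R free_lie
  free_bracketDl free_bracketDr free_bracketZl free_bracketZr
  free_bracketxx free_bracketJ.

Definition free_gen (x : X) : free_lie := free_pi (LGen x).

End FreeLie.

Section Metabelian.
Variables (R : comNzRingType) (X : Type).

Definition free_metabelian : lieAlgType R :=
  lie_quot (fun u : free_lie R X =>
    exists a b c d, u = bracket (bracket a b) (bracket c d)).

Definition metab_gen (x : X) : free_metabelian := lie_pi _ (free_gen R x).

End Metabelian.

Record sgraph (X : finType) := SGraph {
  adj : rel X;
  adj_sym : symmetric adj;
  adj_irrefl : irreflexive adj
}.

Definition pc_metabelian (R : comNzRingType) (X : finType) (G : sgraph X) :
    lieAlgType R :=
  lie_quot (fun u : free_metabelian R X =>
    exists2 p : X * X, adj G p.1 p.2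
                     & u = bracket (metab_gen R p.1) (metab_gen R p.2)).

(* [G] is the cycle x_0 - x_1 - ... - x_(n-1) - x_0; [ordS] is the successor
   modulo [n]. *)
Definition is_cycle_graph (n : nat) (X : finType) (x : 'I_n -> X)
    (G : sgraph X) : Prop :=
  bijective x /\
  forall i j, adj G (x i) (x j) = (j == ordS i) || (i == ordS j).

Inductive fo_term (k : nat) : Type :=
| TVar of 'I_k
| TZero
| TAdd of fo_term k & fo_term k
| TBracket of fo_term k & fo_term k.

Inductive qf_formula (k : nat) : Type :=
| FEq of fo_term k & fo_term k
| FFalse
| FNot of qf_formula k
| FAnd of qf_formula k & qf_formula k
| FOr of qf_formula k & qf_formula k
| FImp of qf_formula k & qf_formula k.

(* [Universal F] with [F : qf_formula k] stands for forall w_0 ... w_(k-1), F. *)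
Inductive universal_sentence : Type :=
| Universal (k : nat) of qf_formula k.

Section Satisfaction.
Variables (R : comNzRingType) (L : lieAlgType R).

Fixpoint term_eval (k : nat) (w : 'I_k -> L) (t : fo_term k) : L :=
  match t with
  | TVar i => w i
  | TZero => 0
  | TAdd s t => term_eval w s + term_eval w t
  | TBracket s t => bracket (term_eval w s) (term_eval w t)
  end.

Fixpoint qf_holds (k : nat) (w : 'I_k -> L) (F : qf_formula k) : Prop :=
  match F with
  | FEq s t => term_eval w s = term_eval w t
  | FFalse => False
  | FNot F => ~ qf_holds w F
  | FAnd F G => qf_holds w F /\ qf_holds w G
  | FOr F G => qf_holds w F \/ qf_holds w G
  | FImp F G => qf_holds w F -> qf_holds w G
  end.

Definition satisfies (s : universal_sentence) : Prop :=
  let: Universal k F := s in forall w : 'I_k -> L, qf_holds w F.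

End Satisfaction.

Definition universally_equivalent (R : comNzRingType) (L M : lieAlgType R) :
    Prop :=
  forall s : universal_sentence, satisfies L s <-> satisfies M s.

(* Main.v *)
(** The derived ideal of the partially commutative algebra is graded by
    multidegrees. Its component of multidegree [m] is spanned by the brackets
    [g_i, g_j] acted on by generators; by the Jacobi identity such an element
    is [h j - h i] for a potential [h] on the support [S] of [m], and [h] is
    constant on the connected components of the graph induced on [S].
    Conversely a function [f] that is locally constant on a vertex set [S]
    gives a morphism to the semidirect product of two copies of [R[x]], the
    first acting on the second by multiplication: [g_k] goes to
    [(x_k, f_k x_k)] for [k] in [S] and to [0] otherwise. So an element of the
    derived ideal vanishes iff all these morphisms kill it.

    Consequently an element [w] with linear part [u] kills [c] in the derived
    ideal iff all the generators in the support of [u] do. On a cycle a nonzero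
    [c] is killed by at most two generators: if three vertices are removed, a
    locally constant function is a sum of three functions supported on the
    arcs, each of which extends by zero to the vertex opposite to its arc.

    For [p >= 5] the separating sentence says that no [w_a] ([a] modulo [p])
    are such that, for all [a], the bracket of [w_(a+1)] and [w_(a+3)] acted on
    by the [w_d] with [d] outside [a, ..., a+3] is killed by [w_a] and
    [w_(a+2)] and by no other [w_d]. The generators of the [p]-cycle violate
    it. In the [q]-cycle such [w_a] would have linear parts supported on
    single, pairwise distinct vertices, so [p <= q]. The remaining pair 3, 4 is
    separated by commutativity. *)

Require Import Defs.
From HB Require Import structures.
From mathcomp Require Import all_boot all_order all_algebra.
From mathcomp Require Import boolp mpoly ring zify.

Set Implicit Arguments.
Unset Strict Implicit.
Unset Printing Implicit Defensive.

Import GRing.Theory.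
Local Open Scope ring_scope.

(** * Lie morphisms *)

Section LieMorphisms.
Variable R : comNzRingType.
Implicit Types L M N : lieAlgType R.

Definition lie_morph L M (phi : L -> M) : Prop :=
  [/\ forall u v, phi (u + v) = phi u + phi v,
      forall a u, phi (a *: u) = a *: phi u
    & forall u v, phi (bracket u v) = bracket (phi u) (phi v)].

Lemma lie_morph0 L M (phi : L -> M) : lie_morph phi -> phi 0 = 0.
Proof. by case=> _ pZ _; rewrite -(scale0r 0) pZ scale0r. Qed.

Lemma lie_morphN L M (phi : L -> M) u : lie_morph phi -> phi (- u) = - phi u.
Proof. by case=> _ pZ _; rewrite -scaleN1r pZ scaleN1r. Qed.

Lemma lie_morph_sum L M (phi : L -> M) I (r : seq I) (F : I -> L) :
  lie_morph phi -> phi (\sum_(i <- r) F i) = \sum_(i <- r) phi (F i).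
Proof.
move=> hp; case: (hp) => pD _ _.
by apply: (big_morph phi pD); apply: lie_morph0.
Qed.

Lemma lie_morph_comp L M N (phi : L -> M) (psi : M -> N) :
  lie_morph phi -> lie_morph psi -> lie_morph (psi \o phi).
Proof.
move=> [pD pZ pB] [qD qZ qB].
by split=> * /=; rewrite ?pD ?pZ ?pB ?qD ?qZ ?qB.
Qed.

Lemma bracket0l L (u : L) : bracket 0 u = 0.
Proof. by rewrite -{1}(scale0r 0) bracketZl scale0r. Qed.

Lemma bracket0r L (u : L) : bracket u 0 = 0.
Proof. by rewrite -{1}(scale0r 0) bracketZr scale0r. Qed.

Lemma bracket_suml L I (r : seq I) (F : I -> L) u :
  bracket (\sum_(i <- r) F i) u = \sum_(i <- r) bracket (F i) u.
Proof.
by apply: (big_morph (fun v => bracket v u)) => [v w|];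
  rewrite ?bracketDl ?bracket0l.
Qed.

Lemma bracket_sumr L I (r : seq I) (F : I -> L) u :
  bracket u (\sum_(i <- r) F i) = \sum_(i <- r) bracket u (F i).
Proof.
by apply: (big_morph (bracket u)) => [v w|]; rewrite ?bracketDr ?bracket0r.
Qed.

Definition quot_lift L M (S : L -> Prop) (phi : L -> M) (u : lie_quot S) : M :=
  phi (lie_rep u).

(** The kernel of [phi] is an ideal containing [S], so [phi] takes one value on all representatives
    of a class. *)
Lemma quot_lift_pi L M (S : L -> Prop) (phi : L -> M) u :
  lie_morph phi -> (forall v, S v -> phi v = 0) ->
  quot_lift phi (lie_pi S u) = phi u.
Proof.
move=> hp Sphi; case: (hp) => pD pZ pB; apply/eqP; rewrite -subr_eq0.
rewrite -(lie_morphN _ hp) -pD; apply/eqP.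
have /lie_piP Su : lie_pi S (lie_rep (lie_pi S u)) = lie_pi S u.
  by rewrite lie_repK.
apply: (Su (fun v => phi v = 0)) => // {u Su}.
split=> [|u v hu hv|a u hu|u v hv].
- exact: lie_morph0.
- by rewrite pD hu hv addr0.
- by rewrite pZ hu scaler0.
- by rewrite pB hv bracket0r.
Qed.

Lemma quot_lift_morph L M (S : L -> Prop) (phi : L -> M) :
  lie_morph phi -> (forall v, S v -> phi v = 0) ->
  lie_morph (@quot_lift L M S phi).
Proof.
move=> hp Sphi; case: (hp) => pD pZ pB.
split=> [u v|a u|u v]; rewrite -[u]lie_repK.
- by rewrite -[v]lie_repK -lie_piD !quot_lift_pi.
- by rewrite -lie_piZ !quot_lift_pi.
- by rewrite -[v]lie_repK -lie_piB !quot_lift_pi.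
Qed.

Definition metabelian L : Prop :=
  forall a b c d : L, bracket (bracket a b) (bracket c d) = 0.

Lemma quot_metabelian L (S : L -> Prop) :
  (forall a b c d, ideal_gen S (bracket (bracket a b) (bracket c d))) ->
  metabelian (lie_quot S).
Proof.
move=> Smet a b c d.
rewrite -[a]lie_repK -[b]lie_repK -[c]lie_repK -[d]lie_repK -!lie_piB.
by rewrite -[RHS](lie_pi0 _); apply/lie_piP; rewrite subr0.
Qed.

Section FreeLift.
Variables (X : Type) (M : lieAlgType R) (h : X -> M).

Fixpoint expr_eval (e : lie_expr R X) : M :=
  match e with
  | LGen x => h x
  | LZero => 0
  | LAdd s t => expr_eval s + expr_eval t
  | LOpp s => - expr_eval s
  | LScale a s => a *: expr_eval s
  | LBracket s t => bracket (expr_eval s) (expr_eval t)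
  end.

Lemma expr_eval_congr s t : lie_congr s t -> expr_eval s = expr_eval t.
Proof.
elim=> //= {s t}.
- by move=> s t u _ -> _ ->.
- by move=> s s' t t' _ -> _ ->.
- by move=> s s' _ ->.
- by move=> a s s' _ ->.
- by move=> s s' t t' _ -> _ ->.
- by move=> *; rewrite addrA.
- by move=> *; rewrite addrC.
- by move=> *; rewrite add0r.
- by move=> *; rewrite addNr.
- by move=> *; rewrite scalerA.
- by move=> *; rewrite scale1r.
- by move=> *; rewrite scalerDr.
- by move=> *; rewrite scalerDl.
- by move=> *; rewrite bracketDl.
- by move=> *; rewrite bracketDr.
- by move=> *; rewrite bracketZl.
- by move=> *; rewrite bracketZr.
- by move=> *; rewrite bracketxx.
- by move=> *; rewrite bracketJ.
Qed.

Definition free_lift (u : free_lie R X) : M := expr_eval (free_rep u).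

Lemma free_lift_pi e : free_lift (free_pi e) = expr_eval e.
Proof. exact/expr_eval_congr/free_rep_pi. Qed.

Lemma free_lift_morph : lie_morph free_lift.
Proof.
split=> [u v|a u|u v]; rewrite -[u]free_repK.
- by rewrite -[v]free_repK [_ + _]free_piD !free_lift_pi.
- by rewrite [_ *: _]free_piZ !free_lift_pi.
- by rewrite -[v]free_repK [bracket _ _]free_piB !free_lift_pi.
Qed.

End FreeLift.

End LieMorphisms.

(** * Universal property of the partially commutative algebra *)

Section PartiallyCommutative.
Variables (R : comNzRingType) (X : finType) (G : sgraph X).

Definition pc_gen (x : X) : pc_metabelian R G := lie_pi _ (metab_gen R x).

Lemma pc_metabelianP : metabelian (pc_metabelian R G).
Proof.
apply: quot_metabelian => a b c d; rewrite (_ : bracket _ _ = 0).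
  by have [] := ideal_gen_ideal (fun u : free_metabelian R X =>
    exists2 p : X * X, adj G p.1 p.2
                     & u = bracket (metab_gen R p.1) (metab_gen R p.2)).
apply: (@quot_metabelian _ (free_lie R X)) => {}a {}b {}c {}d I _; apply.
by exists a, b, c, d.
Qed.

Lemma pc_gen_adj x y : adj G x y -> bracket (pc_gen x) (pc_gen y) = 0.
Proof.
move=> xy; rewrite -lie_piB -[RHS](lie_pi0 _); apply/lie_piP.
by rewrite subr0 => I _; apply; exists (x, y).
Qed.

Lemma pc_ind (P : pc_metabelian R G -> Prop) :
  (forall x, P (pc_gen x)) -> P 0 ->
  (forall u v, P u -> P v -> P (u + v)) -> (forall a u, P u -> P (a *: u)) ->
  (forall u v, P u -> P v -> P (bracket u v)) -> forall u, P u.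
Proof.
move=> Pg P0 PD PZ PB u; rewrite -[u]lie_repK -[lie_rep u]lie_repK.
rewrite -[lie_rep _]free_repK; elim: (free_rep _) => {u} //=.
- by rewrite [free_pi _](_ : _ = 0) // !lie_pi0.
- by move=> s Ps t Pt; rewrite -free_piD !lie_piD; apply: PD.
- move=> s Ps; rewrite -free_piN.
  rewrite [free_opp _](_ : _ = - free_pi s) // -scaleN1r !lie_piZ.
  exact: PZ.
- by move=> a s Ps; rewrite -free_piZ !lie_piZ; apply: PZ.
- by move=> s Ps t Pt; rewrite -free_piB !lie_piB; apply: PB.
Qed.

(** Universal property among metabelian algebras: evaluation of formal expressions descends through
    both quotients. *)
Lemma pc_lift (M : lieAlgType R) (h : X -> M) :
  metabelian M ->
  (forall x y, adj G x y -> bracket (h x) (h y) = 0) ->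
  exists2 phi : pc_metabelian R G -> M, lie_morph phi
    & forall x, phi (pc_gen x) = h x.
Proof.
move=> Mmet hadj.
have m1 := free_lift_morph h.
have z1 v : (exists a b c d, v = bracket (bracket a b) (bracket c d)) ->
    free_lift h v = 0.
  by case: m1 => _ _ mB [a [b [c [d ->]]]]; rewrite !mB Mmet.
have m2 := quot_lift_morph m1 z1.
have g2 x : quot_lift (free_lift h) (metab_gen R x) = h x.
  by rewrite quot_lift_pi // free_lift_pi.
have z2 v : (exists2 p : X * X, adj G p.1 p.2
    & v = bracket (metab_gen R p.1) (metab_gen R p.2)) ->
    quot_lift (free_lift h) v = 0.
  by case: (m2) => _ _ mB [p pG ->]; rewrite mB !g2 hadj.
exists (quot_lift (quot_lift (free_lift h))); first exact: quot_lift_morph.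
by move=> x; rewrite quot_lift_pi.
Qed.

Lemma pc_morph_ext (M : lieAlgType R) (phi psi : pc_metabelian R G -> M) :
  lie_morph phi -> lie_morph psi ->
  (forall x, phi (pc_gen x) = psi (pc_gen x)) ->
  phi =1 psi.
Proof.
move=> hp hq e; have [pD pZ pB] := hp; have [qD qZ qB] := hq.
elim/pc_ind=> //; first by rewrite !lie_morph0.
- by move=> u v pu pv; rewrite pD qD pu pv.
- by move=> a u pu; rewrite pZ qZ pu.
- by move=> u v pu pv; rewrite pB qB pu pv.
Qed.

End PartiallyCommutative.

Lemma lie_id_morph (R : comNzRingType) (L : lieAlgType R) : lie_morph (@id L).
Proof. by []. Qed.

(** * Transfer of sentences along embeddings *)

Section Transfer.
Variable R : comNzRingType.

(** An injective morphism preserves and reflects equations between terms, hence their Boolean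
    combinations. *)
Lemma qf_holds_inj (L M : lieAlgType R) (phi : L -> M) k (w : 'I_k -> L)
    (F : qf_formula k) :
  lie_morph phi -> injective phi -> qf_holds (phi \o w) F <-> qf_holds w F.
Proof.
move=> hp inj; have [pD pZ pB] := hp.
have te t : term_eval (phi \o w) t = phi (term_eval w t).
  by elim: t => //= [|s -> t ->|s -> t ->]; rewrite ?lie_morph0.
elim: F => /=; try by move=> *; tauto.
by move=> s t; rewrite !te; split=> [/inj|->].
Qed.

Lemma satisfies_inj (L M : lieAlgType R) (phi : L -> M) s :
  lie_morph phi -> injective phi -> satisfies M s -> satisfies L s.
Proof.
by move=> hp inj; case: s => k F Ms w; apply/(qf_holds_inj _ _ hp inj)/Ms.
Qed.

Lemma pc_iso (X Y : finType) (G : sgraph X) (H : sgraph Y) (e : X -> Y) :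
  bijective e -> (forall a b, adj G a b = adj H (e a) (e b)) ->
  universally_equivalent (pc_metabelian R G) (pc_metabelian R H).
Proof.
case=> e' eK e'K eadj.
have [phi hp pe] := @pc_lift R X G _ (fun x => pc_gen R H (e x))
  (@pc_metabelianP R Y H) ltac:(by move=> x y; rewrite eadj; apply: pc_gen_adj).
have [psi hq qe] := @pc_lift R Y H _ (fun y => pc_gen R G (e' y))
  (@pc_metabelianP R X G)
  ltac:(by move=> x y; rewrite -{1}[x]e'K -{1}[y]e'K -eadj; apply: pc_gen_adj).
have pK : cancel phi psi.
  apply: (pc_morph_ext (lie_morph_comp hp hq) (@lie_id_morph _ _)) => x /=.
  by rewrite pe qe eK.
have qK : cancel psi phi.
  apply: (pc_morph_ext (lie_morph_comp hq hp) (@lie_id_morph _ _)) => x /=.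
  by rewrite qe pe e'K.
by move=> s; split; apply: satisfies_inj; eauto using can_inj.
Qed.

End Transfer.

(** * The derived ideal *)

Section Semidirect.
Variables (R : comNzRingType) (A : comAlgType R).

Definition semidirect : Type := (A * A)%type.

HB.instance Definition _ := GRing.Lmodule.on semidirect.

(** Both factors are abelian; the first acts on the second by multiplication. *)
Definition semi_bracket (u v : semidirect) : semidirect :=
  (0, u.1 * v.2 - v.1 * u.2).

Fact semi_bracketDl u v w :
  semi_bracket (u + v) w = semi_bracket u w + semi_bracket v w.
Proof. by congr (_, _) => /=; [rewrite addr0 | ring]. Qed.

Fact semi_bracketDr u v w :
  semi_bracket u (v + w) = semi_bracket u v + semi_bracket u w.
Proof. by congr (_, _) => /=; [rewrite addr0 | ring]. Qed.

Fact semi_bracketZl a u v : semi_bracket (a *: u) v = a *: semi_bracket u v.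
Proof.
by congr (_, _); rewrite /= ?scaler0 // scalerBr -scalerAl -scalerAr.
Qed.

Fact semi_bracketZr a u v : semi_bracket u (a *: v) = a *: semi_bracket u v.
Proof.
by congr (_, _); rewrite /= ?scaler0 // scalerBr -scalerAl -scalerAr.
Qed.

Fact semi_bracketxx u : semi_bracket u u = 0.
Proof. by congr (_, _) => /=; ring. Qed.

Fact semi_bracketJ u v w :
  semi_bracket u (semi_bracket v w) + semi_bracket v (semi_bracket w u)
    + semi_bracket w (semi_bracket u v) = 0.
Proof. by congr (_, _) => /=; rewrite ?addr0 //; ring. Qed.

HB.instance Definition _ := Lmodule_isLieAlg.Build R semidirect
  semi_bracketDl semi_bracketDr semi_bracketZl semi_bracketZr
  semi_bracketxx semi_bracketJ.

Lemma semidirect_metabelian : metabelian semidirect.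
Proof. by move=> a b c d; congr (_, _) => /=; ring. Qed.

End Semidirect.

(* [Koszul a s i j] encodes [a] times the bracket [g_i, g_j] acted on by the
   generators in [s]. *)
Record koszul (R : Type) (n : nat) :=
  Koszul { kc : R; ks : seq 'I_n; ki : 'I_n; kj : 'I_n }.

HB.instance Definition _ (R : Type) (n : nat) := gen_eqMixin (koszul R n).

(** * Monomials spanning the derived ideal *)

Section Monomials.
Variables (R : idomainType) (n : nat) (G : sgraph 'I_n).

Local Notation L := (pc_metabelian R G).
Local Notation g := (pc_gen R G).

Definition adl (s : seq 'I_n) (c : L) : L := foldr (fun k => bracket (g k)) c s.

(** The third term of the Jacobi identity vanishes by metabelianity: the algebra acts on its derived
    ideal by commuting operators. *)
Lemma bracket_swap (x y u v : L) :
  bracket x (bracket y (bracket u v)) = bracket y (bracket x (bracket u v)).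
Proof.
have := bracketJ x y (bracket u v).
rewrite [bracket (bracket u v) (bracket x y)]pc_metabelianP addr0.
by rewrite (bracketC (bracket u v)) bracketNr => /eqP; rewrite subr_eq0 => /eqP.
Qed.

Lemma adl_bracket s (u v : L) :
  exists u' v', adl s (bracket u v) = bracket u' v'.
Proof.
by case: s => [|k s]; [exists u, v | exists (g k), (adl s (bracket u v))].
Qed.

Lemma adl_metab s (u v x y : L) :
  bracket (bracket x y) (adl s (bracket u v)) = 0.
Proof. by have [u' [v' ->]] := adl_bracket s u v; apply: pc_metabelianP. Qed.

Lemma adl_rem k s (u v : L) :
  k \in s -> adl s (bracket u v) = adl (k :: rem k s) (bracket u v).
Proof.
elim: s => //= l s IH; rewrite inE; case: eqVneq => [->|kl] //=.
move=> /IH ->; rewrite /=.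
by have [u' [v' ->]] := adl_bracket (rem k s) u v; apply: bracket_swap.
Qed.

Lemma adl_perm s s' (u v : L) :
  perm_eq s s' -> adl s (bracket u v) = adl s' (bracket u v).
Proof.
elim: s s' => [|k s IH] s'; first by rewrite perm_sym => /perm_nilP ->.
move=> ss'.
have ks' : k \in s' by rewrite -(perm_mem ss') mem_head.
rewrite (adl_rem _ _ ks') /= (IH (rem k s')) //.
by rewrite -(perm_cons k) (perm_trans ss') // perm_to_rem.
Qed.

Lemma adl0 s : adl s 0 = 0.
Proof. by elim: s => //= k s ->; rewrite bracket0r. Qed.

Lemma adlD s : {morph adl s : u v / u + v}.
Proof. by move=> u v; elim: s => //= k s ->; rewrite bracketDr. Qed.

Lemma adlN s : {morph adl s : u / - u}.
Proof. by move=> u; elim: s => //= k s ->; rewrite bracketNr. Qed.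

Local Notation koszul := (koszul R n).

Definition kval (t : koszul) : L :=
  kc t *: adl (ks t) (bracket (g (ki t)) (g (kj t))).

(** Such a list is not unique, but it can be evaluated both in the algebra and in its polynomial
    models. *)
Definition ksum (l : seq koszul) : L := \sum_(t <- l) kval t.

Definition kscale (a : R) (t : koszul) :=
  Koszul (a * kc t) (ks t) (ki t) (kj t).

Definition kshift (k : 'I_n) (t : koszul) :=
  Koszul (kc t) (k :: ks t) (ki t) (kj t).

Definition klin (u : 'I_n -> R) (l : seq koszul) : seq koszul :=
  flatten [seq map (kscale (u k) \o kshift k) l | k <- enum 'I_n].

Lemma ksum_cat l l' : ksum (l ++ l') = ksum l + ksum l'.
Proof. by rewrite /ksum big_cat. Qed.

Lemma ksum_scale a l : ksum (map (kscale a) l) = a *: ksum l.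
Proof.
by rewrite /ksum big_map scaler_sumr; apply: eq_bigr => t _; rewrite scalerA.
Qed.

Lemma ksum_shift k l : ksum (map (kshift k) l) = bracket (g k) (ksum l).
Proof.
by rewrite /ksum big_map bracket_sumr; apply: eq_bigr => t _; rewrite bracketZr.
Qed.

Lemma ksum_klin u l : ksum (klin u l) = bracket (\sum_k u k *: g k) (ksum l).
Proof.
rewrite /ksum big_flatten big_map big_enum bracket_suml /=.
apply: eq_bigr => k _; rewrite map_comp -/(ksum _) ksum_scale ksum_shift.
by rewrite bracketZl.
Qed.

Lemma ksum_comm l l' : bracket (ksum l) (ksum l') = 0.
Proof.
rewrite bracket_suml big1 // => t _; rewrite bracket_sumr big1 // => t' _.
rewrite bracketZl bracketZr.
have [u' [v' ->]] := adl_bracket (ks t) (g (ki t)) (g (kj t)).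
by rewrite adl_metab !scaler0.
Qed.

Lemma bracket_decomp u l v l' :
  exists l'', bracket (\sum_k u k *: g k + ksum l) (\sum_k v k *: g k + ksum l')
    = ksum l''.
Proof.
(* The lists come from the bracket of the two linear parts, the action of [u] on [l'] and, by
   antisymmetry, minus the action of [v] on [l]. *)
exists ([seq Koszul (u p.1 * v p.2) [::] p.1 p.2 | p : ('I_n * 'I_n)%type]
  ++ klin u l' ++ map (kscale (- 1)) (klin v l)).
rewrite bracketDl !bracketDr ksum_comm addr0 !ksum_cat ksum_klin ksum_scale.
rewrite ksum_klin scaleN1r -(bracketC (ksum l)) -addrA; congr (_ + _).
rewrite /ksum big_image bracket_suml.
transitivity (\sum_i \sum_j (u i * v j) *: bracket (g i) (g j)).
  apply: eq_bigr => i _; rewrite bracket_sumr; apply: eq_bigr => j _.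
  by rewrite bracketZl bracketZr scalerA.
by rewrite pair_big; apply: eq_bigr.
Qed.

Lemma decomp (w : L) : exists u l, w = \sum_k u k *: g k + ksum l.
Proof.
elim/pc_ind: w => [k||w w' [u [l ->]] [u' [l' ->]]|a w [u [l ->]]|].
- exists (fun j => (j == k)%:R), [::]; rewrite /ksum big_nil addr0.
  rewrite (bigD1 k) //= eqxx scale1r big1 ?addr0 // => j /negbTE ->.
  exact: scale0r.
- exists (fun=> 0), [::]; rewrite /ksum big_nil addr0 big1 // => k _.
  exact: scale0r.
- exists (fun k => u k + u' k), (l ++ l'); rewrite ksum_cat addrACA -big_split.
  by congr (_ + _); apply: eq_bigr => k _; rewrite scalerDl.
- exists (fun k => a * u k), (map (kscale a) l); rewrite ksum_scale scalerDr.
  by rewrite scaler_sumr; congr (_ + _); apply: eq_bigr => k _; rewrite scalerA.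
- move=> w w' [u [l ->]] [u' [l' ->]].
  have [l'' ->] := bracket_decomp u l u' l'.
  exists (fun=> 0), l''; rewrite big1 ?add0r // => k _; exact: scale0r.
Qed.

Lemma bracket_ksum (w w' : L) : exists l, bracket w w' = ksum l.
Proof.
by have [u [l ->]] := decomp w; have [u' [l' ->]] := decomp w';
  apply: bracket_decomp.
Qed.

End Monomials.

(** * The vanishing criterion *)

Section Criterion.
Variables (R : idomainType) (n : nat) (G : sgraph 'I_n).

Local Notation L := (pc_metabelian R G).
Local Notation g := (pc_gen R G).
Local Notation P := {mpoly R[n]}.
Local Notation koszul := (koszul R n).

Definition loc_const (S : pred 'I_n) (f : 'I_n -> R) : Prop :=
  forall i j, S i -> S j -> adj G i j -> f i = f j.

Definition kword (t : koszul) : seq 'I_n := ki t :: kj t :: ks t.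

Definition word_mon (s : seq 'I_n) : 'X_{1..n} := (\sum_(k <- s) U_(k))%MM.

Definition kvar (S : pred 'I_n) (k : 'I_n) : P := if S k then 'X_k else 0.

(** For [f] locally constant on [S], this is the second coordinate of the image of [ksum G l] in the
    model given by [S] and [f]. *)
Definition kpoly (S : pred 'I_n) (f : 'I_n -> R) (l : seq koszul) : P :=
  \sum_(t <- l) (kc t * (f (kj t) - f (ki t))) *: \prod_(k <- kword t) kvar S k.

(** The coefficient of [m] in [kpoly S f l] for any [S] containing the support of [m]. *)
Definition kcoef (m : 'X_{1..n}) (f : 'I_n -> R) (l : seq koszul) : R :=
  \sum_(t <- l | word_mon (kword t) == m) kc t * (f (kj t) - f (ki t)).

Lemma word_monE s k : word_mon s k = count_mem k s.
Proof.
rewrite /word_mon mnm_sumE; elim: s => [|l s IH]; first by rewrite big_nil.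
by rewrite big_cons mnmE IH /=.
Qed.

Lemma word_mon_perm s s' : word_mon s = word_mon s' -> perm_eq s s'.
Proof.
by move=> e; apply/allP => k _ /=; rewrite -!word_monE e.
Qed.

Lemma word_mon_gt0 s k : (word_mon s k != 0%N) = (k \in s).
Proof. by rewrite word_monE -lt0n -has_count has_pred1. Qed.

Lemma kword_prodE (S : pred 'I_n) s (m : 'X_{1..n}) :
  (forall k, m k != 0%N -> S k) ->
  (\prod_(k <- s) kvar S k)@_m = (word_mon s == m)%:R.
Proof.
move=> mS; have [sS|/allPn[k ks kS]] := boolP (all S s).
  rewrite -mcoeffX /word_mon; congr (_@_m).
  elim: s sS => [|k s IH] /=; first by rewrite !big_nil mpolyX0.
  by case/andP=> Sk sS; rewrite !big_cons mpolyXD IH // /kvar Sk.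
rewrite (big_rem k) //= /kvar (negbTE kS) mul0r mcoeff0.
case: eqP => // e; case/negP: kS; apply: mS.
by rewrite -e word_mon_gt0.
Qed.

Lemma kpoly_coef (S : pred 'I_n) f l (m : 'X_{1..n}) :
  (forall k, m k != 0%N -> S k) -> (kpoly S f l)@_m = kcoef m f l.
Proof.
move=> mS; rewrite /kpoly /kcoef raddf_sum /= [RHS]big_mkcond /=.
apply: eq_bigr => t _; rewrite mcoeffZ kword_prodE //.
by case: eqP => _; rewrite ?mulr1 ?mulr0.
Qed.

Lemma kpoly_klin (S : pred 'I_n) f u l :
  kpoly S f (klin u l) = (\sum_k u k *: kvar S k) * kpoly S f l.
Proof.
rewrite /kpoly big_flatten big_map big_enum mulr_suml /=.
apply: eq_bigr => k _; rewrite big_map mulr_sumr; apply: eq_bigr => t _ /=.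
rewrite !big_cons -scalerAl -scalerAr scalerA; congr (_ *: _); ring.
Qed.

Section Model.
Variables (S : pred 'I_n) (f : 'I_n -> R).

(** The images of [g i] and [g j] have bracket [(0, (f j - f i) x_i x_j)], with the variables
    outside [S] set to zero; this vanishes on edges. *)
Lemma kmodel : loc_const S f ->
  exists2 phi : L -> semidirect P, lie_morph phi
    & forall k, phi (g k) = (kvar S k, f k *: kvar S k).
Proof.
move=> fS; apply: pc_lift; first exact: semidirect_metabelian.
move=> i j ij; congr (_, _) => /=; rewrite -!scalerAr /kvar.
case Si: (S i); last by rewrite mul0r mulr0 !scaler0 subrr.
case Sj: (S j); last by rewrite mul0r mulr0 !scaler0 subrr.
by rewrite (fS i j) // mulrC subrr.
Qed.

Lemma ksum0_kpoly l : loc_const S f -> ksum G l = 0 -> kpoly S f l = 0.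
Proof.
move=> /kmodel[phi hp pg] l0; have [pD pZ pB] := hp.
suff E : phi (ksum G l) = (0, kpoly S f l).
  by have := lie_morph0 hp; rewrite -l0 E => -[].
have adlE s c p : phi c = (0, p) ->
    phi (adl s c) = (0, (\prod_(k <- s) kvar S k) * p).
  move=> pc; elim: s => [|k s IH] /=; first by rewrite big_nil mul1r.
  rewrite pB pg IH big_cons; congr (_, _) => /=.
  by rewrite mul0r subr0 mulrA.
rewrite (lie_morph_sum _ _ hp) /kpoly.
elim: l {l0} => [|t l IH]; first by rewrite !big_nil.
rewrite !big_cons IH pZ.
rewrite (@adlE _ _ ((f (kj t) - f (ki t)) *: (kvar S (ki t) * kvar S (kj t)))).
  congr (_, _) => /=; first by rewrite scaler0 addr0.
  by congr (_ + _); rewrite -scalerAr scalerA mulrA [X in _ = _ *: X]mulrC.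
rewrite pB !pg; congr (_, _) => /=.
by rewrite -!scalerAr scalerBl [kvar S (kj t) * _]mulrC.
Qed.

End Model.

Section Grouping.
Variables (r : 'I_n) (d : seq 'I_n).

(* Up to the choice of the base point [r], this is the potential attached to the
   multidegree of the word [r :: d]. *)
Definition kpot (i : 'I_n) : L :=
  if i == r then 0 else adl (rem i d) (bracket (g r) (g i)).

Lemma perm_cons_rem i (s s' : seq 'I_n) :
  perm_eq (i :: s) s' -> perm_eq s (rem i s').
Proof.
move=> p; rewrite -(perm_cons i) (perm_trans p) // perm_to_rem //.
by rewrite -(perm_mem p) mem_head.
Qed.

(** For distinct [i], [j], [r] this is the Jacobi identity of their generators, acted on by the
    remaining letters. *)
Lemma kpot_sub i j s : perm_eq [:: i, j & s] (r :: d) ->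
  adl s (bracket (g i) (g j)) = kpot j - kpot i.
Proof.
move=> p; rewrite /kpot.
have [ij|ij] := eqVneq i j; first by rewrite -ij bracketxx adl0 subrr.
have [ir|ir] := eqVneq i r.
  move: p ij; rewrite ir perm_cons => /perm_cons_rem p.
  by rewrite eq_sym => /negbTE ->; rewrite subr0; apply: adl_perm.
have [jr|jr] := eqVneq j r.
  have {}p : perm_eq (i :: s) d.
    rewrite -(perm_cons r); apply: perm_trans p; rewrite jr.
    exact/permPl/(perm_catCA [:: r] [:: i]).
  rewrite sub0r bracketC adlN jr; congr (- _).
  by apply: adl_perm; apply: perm_cons_rem.
have rs : r \in s.
  have := mem_head r d; rewrite -(perm_mem p) !inE eq_sym (negbTE ir).
  by rewrite eq_sym (negbTE jr).
have {}p : perm_eq [:: i, j & rem r s] d.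
  rewrite -(perm_cons r); apply: perm_trans p.
  apply: (@perm_trans _ [:: i, j, r & rem r s]).
    exact/permPl/(perm_catCA [:: r] [:: i; j]).
  by rewrite !perm_cons perm_sym perm_to_rem.
have pi : perm_eq (j :: rem r s) (rem i d) by apply: perm_cons_rem.
have pj : perm_eq (i :: rem r s) (rem j d).
  apply: perm_cons_rem; apply: perm_trans p.
  exact/permPl/(perm_catCA [:: j] [:: i]).
rewrite -(adl_perm _ _ pi) -(adl_perm _ _ pj).
(* Moving the extra letter to the innermost place leaves the common word [rem r s] outside. *)
have rc k : perm_eq (k :: rem r s) (rem r s ++ [:: k]).
  by rewrite cats1 perm_sym perm_rcons.
rewrite (adl_perm _ _ (perm_to_rem rs)) !(adl_perm _ _ (rc _)).
rewrite /adl !foldr_cat /= -!/(adl _ _).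
rewrite -adlN -adlD; congr (adl _ _).
apply/eqP; rewrite -subr_eq0 opprD opprK addrA; apply/eqP.
rewrite -[RHS](bracketJ (g r) (g i) (g j)); congr (_ + _ + _).
by rewrite -bracketNr -bracketC.
Qed.

(** The difference is a word acting on [bracket (g i) (g j)], which is zero on an edge. *)
Lemma kpot_adj i j :
  i \in r :: d -> j \in r :: d -> adj G i j -> kpot i = kpot j.
Proof.
move=> ri rj ij; apply/eqP; rewrite eq_sym -subr_eq0.
rewrite -(@kpot_sub i j (rem j (rem i (r :: d)))) ?pc_gen_adj ?adl0 //.
have ji : j != i by apply: contraTneq ij => ->; rewrite adj_irrefl.
rewrite perm_sym (perm_trans (perm_to_rem ri)) // perm_cons perm_to_rem //.
by move: rj; rewrite (perm_mem (perm_to_rem ri)) inE (negbTE ji).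
Qed.

(** The potential is constant on the components of the graph induced on the letters. Expanding it
    over the indicators of components, named by their roots, leaves coefficients that vanish by
    assumption. *)
Lemma ksum_group (l : seq koszul) (q : pred koszul) :
  (forall t, q t -> perm_eq (kword t) (r :: d)) ->
  (forall f, loc_const (mem (r :: d)) f ->
     \sum_(t <- l | q t) kc t * (f (kj t) - f (ki t)) = 0) ->
  \sum_(t <- l | q t) kval G t = 0.
Proof.
move=> qd H; pose e := [rel x y | [&& x \in r :: d, y \in r :: d & adj G x y]].
pose rt := fingraph.root e; have esym : connect_sym e.
  by apply: sym_connect_sym => x y /=; rewrite adj_sym andbCA.
have hroot x : kpot (rt x) = kpot x.
  have /connectP[p] := connect_root e x; rewrite -/rt; move: (rt x) => z.
  elim: p x => [|y p IH] x /=; first by move=> _ ->.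
  by case/andP => /and3P[xd yd xy] /IH yz /yz ->; rewrite (kpot_adj xd yd).
have hE x : kpot x = \sum_s (rt x == s)%:R *: kpot s.
  rewrite (bigD1 (rt x)) //= eqxx scale1r hroot big1 ?addr0 // => s.
  by rewrite eq_sym => /negbTE ->; rewrite scale0r.
transitivity (\sum_s (\sum_(t <- l | q t)
    kc t * ((rt (kj t) == s)%:R - (rt (ki t) == s)%:R)) *: kpot s);
  last first.
  rewrite big1 // => s _; rewrite (H (fun x => (rt x == s)%:R)) ?scale0r //.
  move=> i j di dj ij; congr (_ == _)%:R.
  by apply/fingraph.rootP=> //; apply/connect1/and3P.
under [RHS]eq_bigr do rewrite scaler_suml.
rewrite exchange_big /=; apply: eq_bigr => t /qd; rewrite /kval => /kpot_sub ->.
rewrite hE (hE (ki t)) -sumrB scaler_sumr; apply: eq_bigr => s _.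
by rewrite -scalerBl scalerA.
Qed.

End Grouping.

(** The polynomial models separate the derived ideal: terms are grouped by multidegree, and
    [ksum_group] kills each group. *)
Lemma kcoef_ksum0 (l : seq koszul) :
  (forall (m : 'X_{1..n}) f,
     loc_const (fun k => m k != 0%N) f -> kcoef m f l = 0) ->
  ksum G l = 0.
Proof.
move=> H; pose ms := undup (map (word_mon \o kword) l).
have -> : ksum G l =
    \sum_(m <- ms) \sum_(t <- l | word_mon (kword t) == m) kval G t.
  rewrite (exchange_big_dep xpredT) //= /ksum big_seq [RHS]big_seq.
  apply: eq_bigr => t tl; rewrite big_mkcond.
  rewrite (bigD1_seq (word_mon (kword t))) ?undup_uniq //=; last first.
    by rewrite mem_undup (map_f (word_mon \o kword)).
  by rewrite eqxx big1 ?addr0 // => m; rewrite eq_sym => /negbTE ->.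
rewrite big_seq big1 // => m; rewrite mem_undup => /mapP[t0 t0l mt0].
(* The base point is the first letter of some term of multidegree [m]. *)
apply: (@ksum_group (ki t0) (kj t0 :: ks t0)) => [t /eqP e|f fS].
  by apply: word_mon_perm; rewrite e mt0.
apply: H => i j; rewrite mt0 !word_mon_gt0; exact: fS.
Qed.

End Criterion.

(** * Annihilators *)

Section Annihilators.
Variables (R : idomainType) (n : nat) (G : sgraph 'I_n).

Local Notation L := (pc_metabelian R G).
Local Notation g := (pc_gen R G).
Local Notation koszul := (koszul R n).

Lemma kpoly_shift (S : pred 'I_n) f k (l : seq koszul) :
  kpoly S f (map (kshift k) l) = kvar R S k * kpoly S f l.
Proof.
rewrite /kpoly big_map mulr_sumr; apply: eq_bigr => t _ /=.
by rewrite /kword !big_cons -scalerAr; congr (_ *: _); ring.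
Qed.

(** The right side says that [i] and [j] lie in one component of the graph induced on the letters;
    this is the criterion for a single term. *)
Lemma adl_bracket_eq0 s i j :
  adl s (bracket (g i) (g j)) = 0 <->
  forall f : 'I_n -> R, loc_const G (mem [:: i, j & s]) f -> f i = f j.
Proof.
pose t : koszul := Koszul 1 s i j.
have -> : adl s (bracket (g i) (g j)) = ksum G [:: t].
  by rewrite /ksum big_seq1 /kval scale1r.
split=> [t0 f fS|H].
  have /(congr1 (mcoeff (word_mon (kword t)))) := ksum0_kpoly fS t0.
  rewrite mcoeff0 kpoly_coef; last by move=> k; rewrite word_mon_gt0.
  rewrite /kcoef big_mkcond big_seq1 eqxx mul1r => /eqP.
  by rewrite subr_eq0 => /eqP ->.
apply: kcoef_ksum0 => m f fS; rewrite /kcoef big_mkcond big_seq1.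
case: eqP => // mt; rewrite mul1r (H f) ?subrr // => x y xS yS.
by apply: fS; rewrite -mt word_mon_gt0.
Qed.

Definition ann (c : L) : {set 'I_n} := [set i | bracket (g i) c == 0].

(** In a model the first element acts as the linear form with coefficients [u] on the variables of
    [S]. Polynomials over a domain have no zero divisors, so if [S] contains [i] and [u i] is
    nonzero, the polynomial of [l] vanishes. *)
Lemma bracket_eq0_ann u l' l :
  bracket (\sum_k u k *: g k + ksum G l') (ksum G l) = 0 <->
  [set i | u i != 0] \subset ann (ksum G l).
Proof.
rewrite bracketDl ksum_comm addr0; split=> [|/subsetP ua]; last first.
  rewrite bracket_suml big1 // => i _; rewrite bracketZl.
  have := ua i; rewrite !inE; have [-> _|_ /(_ isT) /eqP ->] := eqVneq (u i) 0.
    by rewrite scale0r.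
  by rewrite scaler0.
rewrite -ksum_klin => l0; apply/subsetP => i; rewrite !inE => ui.
rewrite -ksum_shift; apply/eqP/kcoef_ksum0 => m f fS.
rewrite -(kpoly_coef (S := fun k => m k != 0%N)) // kpoly_shift.
have /eqP := ksum0_kpoly fS l0; rewrite kpoly_klin mulf_eq0.
case/orP=> /eqP e; last by rewrite e mulr0 mcoeff0.
rewrite /kvar; case: ifP => [mi|_]; last by rewrite mul0r mcoeff0.
case/negP: ui; apply/eqP.
have := congr1 (mcoeff U_(i)%MM) e; rewrite mcoeff0 raddf_sum (bigD1 i) //=.
rewrite mcoeffZ /kvar mi mcoeffXU eqxx mulr1 big1 ?addr0 // => k ki.
rewrite mcoeffZ; case: ifP => _; last by rewrite mcoeff0 mulr0.
by rewrite mcoeffXU (negbTE ki) mulr0.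
Qed.

(** The action of [g k] moves the coefficient of [m] to [U_(k) + m], whose support is that of [m]
    together with [k]. *)
Lemma kcoef_ann k l (m : 'X_{1..n}) f : k \in ann (ksum G l) ->
  loc_const G (fun i => (m i != 0%N) || (i == k)) f -> kcoef m f l = 0.
Proof.
rewrite inE -ksum_shift => /eqP l0 fS.
have /(congr1 (mcoeff (U_(k) + m)%MM)) := ksum0_kpoly fS l0.
rewrite mcoeff0 kpoly_coef => [<-|i]; last first.
  rewrite mnmDE mnm1E [k == i]eq_sym.
  by case: (i == k); rewrite ?orbT ?orbF ?add0n.
rewrite /kcoef big_map; apply: eq_bigl => t /=.
suff -> : word_mon (kword (kshift k t)) = (U_(k) + word_mon (kword t))%MM.
  by rewrite eqm_add2l.
by apply/mnmP => i; rewrite mnmDE !word_monE mnm1E /= eq_sym; lia.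
Qed.

Lemma kcoef_eq (m : 'X_{1..n}) f f' (l : seq koszul) :
  (forall i, m i != 0%N -> f i = f' i) -> kcoef m f l = kcoef m f' l.
Proof.
move=> ff; apply: eq_bigr => t /eqP tm.
by rewrite !ff // -tm word_mon_gt0 !inE eqxx ?orbT.
Qed.

Lemma kcoefD (m : 'X_{1..n}) f f' (l : seq koszul) :
  kcoef m (fun i => f i + f' i) l = kcoef m f l + kcoef m f' l.
Proof. by rewrite /kcoef -big_split; apply: eq_bigr => t _ /=; ring. Qed.

End Annihilators.

(** * Annihilators on cycles *)

Definition cyclic_graph n (G : sgraph 'I_n) : Prop :=
  forall i j, adj G i j = (j == ordS i) || (i == ordS j).

Section Cycles.
Variables (R : idomainType) (n : nat) (G : sgraph 'I_n).
Hypothesis Gcycle : cyclic_graph G.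

Local Notation L := (pc_metabelian R G).
Local Notation g := (pc_gen R G).

(** Adjacency in linear arithmetic, the closing edge apart, in a form that [lia] can use. *)
Lemma cycle_adj i j : adj G i j ->
  [\/ j = i.+1 :> nat, i = j.+1 :> nat, i = n.-1 :> nat /\ j = 0%N :> nat
    | j = n.-1 :> nat /\ i = 0%N :> nat].
Proof.
have S (k : 'I_n) :
    ordS k = k.+1 :> nat \/ k = n.-1 :> nat /\ ordS k = 0%N :> nat.
  have := ltn_ord k; rewrite leq_eqVlt => /orP[/eqP kn|kn] /=.
    by right; split; [lia | rewrite kn modnn].
  by left; rewrite modn_small.
by rewrite Gcycle => /orP[] /eqP ->; [have := S i | have := S j] => -[|[? ?]];
  [constructor 1|constructor 3|constructor 2|constructor 4].
Qed.

Lemma ann_cycle3 (l : seq (koszul R n)) (x y z : 'I_n) : (x < y < z)%N ->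
  x \in ann (ksum G l) -> y \in ann (ksum G l) -> z \in ann (ksum G l) ->
  ksum G l = 0.
Proof.
move=> /andP[xy yz] ax ay az; apply: kcoef_ksum0 => m f fS.
(* Here [a] and [b] bound the arc [A] and [k] is the opposite cut vertex: the restriction of [f] to
   [A] extends by zero to [k]. *)
have arc (A : pred 'I_n) (a b k : 'I_n) : k \in ann (ksum G l) ->
    [/\ m a = 0%N, m b = 0%N, a != k & b != k] -> ~~ A k ->
    (forall i j : 'I_n, [/\ i != a, i != b, j != a & j != b] ->
       adj G i j -> A i = A j) ->
    kcoef m (fun i => if A i then f i else 0) l = 0.
  move=> ak [ma mb nak nbk] nAk AE; apply: kcoef_ann ak _ => i j Si Sj ij.
  have ne h c : m c = 0%N -> c != k -> (m h != 0%N) || (h == k) -> h != c.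
    by move=> mc ck; apply: contraTneq => ->; rewrite mc eqxx.
  have Aij : A i = A j by apply: AE => //; split; apply: ne.
  rewrite -Aij; case: ifP => // Ai; have Aj : A j by rewrite -Aij.
  apply: fS => //.
    by case/orP: Si => // /eqP ik; rewrite -ik Ai in nAk.
  by case/orP: Sj => // /eqP jk; rewrite -jk Aj in nAk.
(* A cut vertex already in the support does not enlarge it, so [f] itself serves. *)
have inS k : k \in ann (ksum G l) -> m k != 0%N -> kcoef m f l = 0.
  move=> ak mk; apply: kcoef_ann ak _ => i j.
  have E h : (m h != 0%N) || (h == k) = (m h != 0%N).
    by have [->|_] := eqVneq h k; rewrite ?mk ?orbF.
  by rewrite !E; apply: fS.
have [mx|/inS->//] := eqVneq (m x) 0%N.
have [my|/inS->//] := eqVneq (m y) 0%N.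
have [mz|/inS->//] := eqVneq (m z) 0%N.
have nS k i : m k = 0%N -> m i != 0%N -> i != k :> nat.
  by move=> mk; apply: contraNneq => /val_inj ->; rewrite mk.
(* On the support [f] is the sum of its restrictions to the arcs; the third arc wraps around the end
   of the numbering. *)
rewrite (@kcoef_eq _ _ _ f (fun i =>
    (if (x < i < y)%N then f i else 0) + (if (y < i < z)%N then f i else 0)
      + (if (i < x)%N || (z < i)%N then f i else 0))); last first.
  move=> i mi; have ix := nS _ _ mx mi; have iy := nS _ _ my mi.
  have iz := nS _ _ mz mi.
  case: ifP => c1; case: ifP => c2; case: ifP => c3;
    rewrite ?addr0 ?add0r //; lia.
have ord i j : adj G i j -> [/\ (i < n)%N, (j < n)%N, (z < n)%N & adj G i j].
  by move=> ij; rewrite !ltn_ord.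
rewrite !kcoefD (arc [pred i : 'I_n | (x < i < y)%N] x y z) //=; first last.
- move=> i j; rewrite -!val_eqE /= => -[? ? ? ?] /ord[? ? ?] /cycle_adj[]; lia.
- lia.
- by rewrite -!val_eqE; split=> //=; lia.
rewrite (arc [pred i : 'I_n | (y < i < z)%N] y z x) //=; first last.
- move=> i j; rewrite -!val_eqE /= => -[? ? ? ?] /ord[? ? ?] /cycle_adj[]; lia.
- lia.
- by rewrite -!val_eqE; split=> //=; lia.
rewrite (arc [pred i : 'I_n | (i < x)%N || (z < i)%N] x z y) ?addr0 //=.
- by rewrite -!val_eqE; split=> //=; lia.
- lia.
- move=> i j; rewrite -!val_eqE /= => -[? ? ? ?] /ord[? ? ?] /cycle_adj[]; lia.
Qed.

Lemma ann_cycle (l : seq (koszul R n)) :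
  ksum G l <> 0 -> (#|ann (ksum G l)| <= 2)%N.
Proof.
move=> l0; rewrite leqNgt; apply/negP => /card_gt2P[x [y [z]]].
case=> -[ax ay az] [xy yz zx]; apply: l0.
have sort3 (a b c : 'I_n) : a != b -> b != c ->
    (a < b < c)%N || (b < c < a)%N || (c < a < b)%N ||
    (a < c < b)%N || (b < a < c)%N || (c < b < a)%N || (a == c).
  by rewrite -!val_eqE /=; lia.
have := sort3 _ _ _ xy yz; rewrite [x == z]eq_sym (negbTE zx) orbF.
by do 5?[case/orP]; move/ann_cycle3; apply.
Qed.

End Cycles.

(** * Separating sentences *)

Section CyclicShift.
Variable n : nat.
Implicit Types i j : 'I_n.

Lemma val_iter_ordS k i : iter k (@ordS n) i = ((i + k) %% n)%N :> nat.
Proof.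
elim: k => [|k IH] /=; first by rewrite addn0 modn_small.
by rewrite IH -addn1 modnDml addn1 addnS.
Qed.

Lemma iter_ordS_inj k k' i : (k < n)%N -> (k' < n)%N ->
  iter k (@ordS n) i = iter k' (@ordS n) i -> k = k'.
Proof.
move=> kn k'n /(congr1 val); rewrite /= !val_iter_ordS => /eqP.
by rewrite eqn_modDl !modn_small // => /eqP.
Qed.

Lemma iter_ordS_n i : iter n (@ordS n) i = i.
Proof. by apply: val_inj; rewrite /= val_iter_ordS modnDr modn_small. Qed.

Lemma ordS_inj : injective (@ordS n).
Proof. exact: can_inj (@ordSK n). Qed.

End CyclicShift.

(* [U d] is the support of [w_d] and [T a] the set of generators killing the
   bracket attached to [a]; [s] is the shift by 2. *)
Lemma exclusive_kills_leq (p q : nat) (s : 'I_p -> 'I_p)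
    (U T : 'I_p -> {set 'I_q}) :
  injective s -> (forall a, s a != a) -> (forall a, s (s a) != a) ->
  (forall a, #|T a| <= 2)%N ->
  (forall a d, (U d \subset T a) = (d == a) || (d == s a)) -> (p <= q)%N.
Proof.
move=> s_inj sN ssN T2 UT.
have [s' s's ss'] := injF_bij s_inj.
have s'N a : s' a != a by apply: contra_neq (sN a) => e; rewrite -{1}e ss'.
have s'sN a : s' a != s a.
  by apply: contra_neq (ssN a) => e; rewrite -e ss'.
have U1 a : exists x, U a = [set x].
  have Ua : U a \subset T a by rewrite UT eqxx.
  have Ua' : U a \subset T (s' a) by rewrite UT ss' eqxx orbT.
  apply/cards1P; rewrite eqn_leq; apply/andP; split.
    (* With two elements, [U a] would fill both [T a] and [T (s' a)], so [U (s' a)] would lie in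
       [T a]. *)
    rewrite leqNgt; apply/negP => U2.
    have Ta : U a = T a by apply/eqP; rewrite eqEcard Ua (leq_trans (T2 a)).
    have Ta' : U a = T (s' a).
      by apply/eqP; rewrite eqEcard Ua' (leq_trans (T2 _)).
    have : U (s' a) \subset T a by rewrite -Ta Ta' UT eqxx.
    by rewrite UT (negbTE (s'N a)) (negbTE (s'sN a)).
  rewrite card_gt0; apply/eqP => U0.
  have : U a \subset T (s a) by rewrite U0 sub0set.
  by rewrite UT ![a == _]eq_sym (negbTE (sN a)) (negbTE (ssN a)).
have /choice[f fU] := U1.
(* If [U a = U b], then [T a] gives [b] in [{a, s a}] and [T (s' a)] gives [b] in [{s' a, a}]; only
   [a] is common. *)
suff /leq_card : injective f by rewrite !card_ord.
move=> a b ab; have Uab : U a = U b by rewrite !fU ab.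
have : U b \subset T a by rewrite -Uab UT eqxx.
rewrite UT => /orP[/eqP //|/eqP bs].
have : U b \subset T (s' a) by rewrite -Uab UT ss' eqxx orbT.
by rewrite UT ss' bs eq_sym (negbTE (s'sN a)) (negbTE (sN a)).
Qed.

Section Sentences.
Variable k : nat.

Definition qf_true : qf_formula k := FNot (@FFalse k).

Definition qf_all (I : Type) (r : seq I) (F : I -> qf_formula k) :
    qf_formula k :=
  foldr (fun i => FAnd (F i)) qf_true r.

Definition qf_kill (s t : fo_term k) : qf_formula k :=
  FEq (TBracket s t) (@TZero k).

Lemma qf_allP (R : comNzRingType) (L : lieAlgType R) (w : 'I_k -> L)
    (I : eqType) (r : seq I) F :
  qf_holds w (qf_all r F) <-> forall i, i \in r -> qf_holds w (F i).
Proof.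
elim: r => [|i r IH] /=; first by split=> // _ [].
split=> [[Fi /IH Fr] j|H].
  by rewrite inE => /predU1P[->|/Fr].
split; first by apply: H; rewrite mem_head.
by apply/IH => j jr; apply: H; rewrite inE jr orbT.
Qed.

End Sentences.

(** * The separating sentence for lengths at least 5 *)

Section CycleSentence.
Variable p : nat.

Definition shift2 (a : 'I_p) : 'I_p := ordS (ordS a).

Definition far_word (a : 'I_p) : seq 'I_p :=
  [seq d <- enum 'I_p | d \notin traject (@ordS p) a 4].

(** The letters are all vertices but [a] and [a+2], each once. Deleting these two isolates [a+1]
    from the arc through [a+3]. *)
Definition cycle_term (a : 'I_p) : fo_term p :=
  foldr (fun d => TBracket (TVar d))
    (TBracket (TVar (ordS a)) (TVar (iter 3 (@ordS p) a))) (far_word a).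

(** The separating universal sentence is the closure of its negation. *)
Definition cycle_formula : qf_formula p :=
  qf_all (enum 'I_p) (fun a => qf_all (enum 'I_p) (fun d =>
    if (d == a) || (d == shift2 a) then qf_kill (TVar d) (cycle_term a)
    else FNot (qf_kill (TVar d) (cycle_term a)))).

Lemma cycle_formulaP (R : comNzRingType) (L : lieAlgType R) (w : 'I_p -> L) :
  qf_holds w cycle_formula <-> forall a d,
    bracket (w d) (term_eval w (cycle_term a)) = 0 <->
    (d == a) || (d == shift2 a).
Proof.
split=> [/qf_allP H a d|H].
  have /qf_allP/(_ d (mem_enum _ _)) := H a (mem_enum _ _).
  by case: ifP.
apply/qf_allP => a _; apply/qf_allP => d _; have := H a d.
by case: ifP => _ /= [H1 H2]; [apply: H2 | move=> /H1].
Qed.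

Lemma cycle_term_bracket (R : comNzRingType) (L : lieAlgType R)
    (w : 'I_p -> L) a :
  exists u v, term_eval w (cycle_term a) = bracket u v.
Proof. by rewrite /cycle_term; case: (far_word a) => [|d s] /=; eauto. Qed.

Local Notation shift k a := (iter k (@ordS p) a).

Hypothesis p5 : (5 <= p)%N.

Lemma iter_ordS_neq i j (a : 'I_p) : (i < p)%N -> (j < p)%N -> i != j ->
  shift i a != shift j a.
Proof. by move=> ip jp; apply: contra_neq; apply: iter_ordS_inj. Qed.

Lemma shift2_neq (a : 'I_p) : shift2 a != a.
Proof. by apply: (@iter_ordS_neq 2 0) => //; lia. Qed.

(** For [p = 4] the shift by 2 is an involution, hence the separate treatment of lengths 3 and 4. *)
Lemma shift22_neq (a : 'I_p) : shift2 (shift2 a) != a.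
Proof. by apply: (@iter_ordS_neq 4 0) => //; lia. Qed.

Lemma mem_cycle_word (a d : 'I_p) :
  (d \in [:: ordS a, shift 3 a & far_word a]) =
    (d != a) && (d != shift2 a).
Proof.
rewrite !inE mem_filter mem_enum andbT !inE.
have [->|] := eqVneq d (ordS a).
  have -> : ordS a != a by apply: (@iter_ordS_neq 1 0); lia.
  by have -> : ordS a != shift2 a by apply: (@iter_ordS_neq 1 2); lia.
have [->|] := eqVneq d (shift 3 a).
  have -> : shift 3 a != a by apply: (@iter_ordS_neq 3 0); lia.
  by have -> : shift 3 a != shift2 a by apply: (@iter_ordS_neq 3 2); lia.
by rewrite /shift2 !orbF negb_or.
Qed.

Variable R : idomainType.

(** By [adl_bracket_eq0], the question is whether adding [d] to the letters joins [a+1] to [a+3];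
    only [a] and [a+2] do. *)
Lemma cycle_formula_holds (G : sgraph 'I_p) :
  cyclic_graph G ->
  qf_holds (pc_gen R G) cycle_formula.
Proof.
move=> Gc; apply/cycle_formulaP => a d.
have -> : term_eval (pc_gen R G) (cycle_term a) = adl (far_word a)
    (bracket (pc_gen R G (ordS a)) (pc_gen R G (shift 3 a))).
  by rewrite /cycle_term /adl; elim: (far_word a) => //= x s ->.
rewrite -[bracket _ (adl _ _)]/(adl (d :: far_word a) _) adl_bracket_eq0.
pose W := [:: ordS a, shift 3 a, d & far_word a].
have memE (f : 'I_p -> R) : loc_const G (mem W) f <->
    loc_const G (fun x => (x == d) || (x != a) && (x != shift2 a)) f.
  have E x : (x \in W) = (x == d) || (x != a) && (x != shift2 a).
    rewrite -mem_cycle_word /W !inE; case: (x == d) => //=; rewrite ?orbT //.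
  split=> H i j Si Sj; apply: H.
  - exact: etrans (E i) Si.
  - exact: etrans (E j) Sj.
  - exact: etrans (esym (E i)) Si.
  - exact: etrans (esym (E j)) Sj.
split=> [H|].
  case da: (d == a) => //=; case ds: (d == shift2 a) => //=.
  (* For any other [d] the vertex [a+1] stays isolated, and its indicator separates it from
     [a+3]. *)
  have := H (fun x => (x == ordS a)%:R); rewrite eqxx.
  have /negbTE -> : shift 3 a != ordS a by apply: (@iter_ordS_neq 3 1); lia.
  move=> K; suff /K/eqP : loc_const G (mem W)
      (fun x => (x == ordS a)%:R : R) by rewrite oner_eq0.
  apply/memE => i j Si Sj.
  have nb x y : (x == d) || (x != a) && (x != shift2 a) -> adj G x y ->
      y == ordS a -> x == ordS a.
    move=> Sx; rewrite Gc => /orP[] /eqP xy /eqP ya.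
      move: Sx; have -> : x = a by apply: ordS_inj; rewrite -xy.
      by rewrite eq_sym da eqxx.
    by move: Sx; rewrite xy ya eq_sym ds eqxx andbF.
  move=> ij; congr (_ %:R); congr nat_of_bool; apply/idP/idP; apply: nb => //.
  by rewrite adj_sym.
move=> da f /memE fS; case/orP: da => /eqP da; rewrite {}da in fS.
  (* For [d = a], the path from [a+3] runs through [a+p = a] to [a+p+1 = a+1]. *)
  have S k : (3 <= k <= p.+1)%N ->
      (shift k a == a) || ((shift k a != a) && (shift k a != shift2 a)).
    case: eqP => //= _ /andP[k3 kp]; apply/eqP.
    have [kp'|] := ltnP k p.
      by apply/eqP; apply: (@iter_ordS_neq k 2) => //; lia.
    rewrite leq_eqVlt => /orP[/eqP <-|pk].
      by rewrite iter_ordS_n; apply/nesym/eqP/shift2_neq.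
    have -> : k = p.+1 by lia.
    by rewrite /= iter_ordS_n => /eqP; apply/negP/(@iter_ordS_neq 1 2); lia.
  have E k : (3 <= k <= p.+1)%N -> f (shift k a) = f (shift 3 a).
    elim: k => [|k IH] // /andP[k3 kp]; have [->//|k3'] := eqVneq k 2.
    rewrite -IH; last lia.
    apply/esym; apply: fS; rewrite ?S //; try lia.
    by rewrite Gc /= eqxx.
  by rewrite -(E p.+1) /= ?iter_ordS_n //; lia.
(* For [d = a+2], the added vertex is a common neighbour of [a+1] and [a+3]. *)
have S x : (x != a) -> (x == shift2 a) || (x != a) && (x != shift2 a).
  by move=> ->; case: eqP.
transitivity (f (shift2 a)); apply: fS;
  rewrite ?S ?shift2_neq ?Gc ?eqxx ?orbT //.
  by apply: (@iter_ordS_neq 1 0); lia.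
by apply: (@iter_ordS_neq 3 0); lia.
Qed.

Lemma cycle_formula_leq q (H : sgraph 'I_q) (w : 'I_p -> pc_metabelian R H) :
  cyclic_graph H ->
  qf_holds w cycle_formula -> (p <= q)%N.
Proof.
move=> Hc /cycle_formulaP wP.
have /choice[u /choice[l' wE]] a := decomp (w a).
have /choice[l lE] a : exists l, term_eval w (cycle_term a) = ksum H l.
  by have [x [y ->]] := cycle_term_bracket w a; apply: bracket_ksum.
apply: (@exclusive_kills_leq p q shift2 (fun a => [set i | u a i != 0])
  (fun a => ann (ksum H (l a)))).
- by move=> a b /ordS_inj/ordS_inj.
- exact: shift2_neq.
- exact: shift22_neq.
(* If the term were zero, [w] at [a+4] would kill it, but [a+4] is neither [a] nor [a+2]. *)
- move=> a; apply: (ann_cycle Hc) => l0.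
  have := wP a (shift2 (shift2 a)); rewrite lE l0 bracket0r => -[/(_ erefl)].
  by rewrite (negbTE (shift22_neq a)) (negbTE (shift2_neq _)).
- move=> a d; apply/idP/idP => [/(bracket_eq0_ann H (u d) (l' d) (l a))|da].
    by rewrite -wE -lE => /wP.
  apply/(bracket_eq0_ann H (u d) (l' d) (l a)).
  by rewrite -wE -lE; apply/wP.
Qed.

End CycleSentence.

(** * Comparison of two cycles *)

Section Main.
Variable R : idomainType.

Definition comm_sentence : universal_sentence :=
  Universal (@qf_kill 2 (TVar ord0) (TVar ord_max)).

(** Distinct vertices of a triangle are adjacent, so locally constant functions are constant on the
    support. *)
Lemma triangle_abelian (G : sgraph 'I_3) :
  cyclic_graph G ->
  satisfies (pc_metabelian R G) comm_sentence.
Proof.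
move=> Gc w /=; have [l ->] := bracket_ksum (w ord0) (w ord_max).
apply: kcoef_ksum0 => m f fS; rewrite /kcoef big1 // => t /eqP tm.
have [->|ij] := eqVneq (ki t) (kj t); first by rewrite subrr mulr0.
rewrite (fS (ki t) (kj t)) ?subrr ?mulr0 //.
- by rewrite -tm word_mon_gt0 !inE eqxx.
- by rewrite -tm word_mon_gt0 !inE eqxx orbT.
rewrite Gc; move: ij; move: (ki t) (kj t).
by case=> [[|[|[|//]]] ?]; case=> [[|[|[|//]]] ?].
Qed.

Lemma cycle_nonabelian n (G : sgraph 'I_n) : (4 <= n)%N ->
  cyclic_graph G ->
  ~ satisfies (pc_metabelian R G) comm_sentence.
Proof.
move=> n4 Gc; have n0 : (0 < n)%N by lia.
have n2 : (2 < n)%N by lia.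
(* Vertices 0 and 2 are not adjacent once the length is at least 4. *)
pose i := Ordinal n0; pose j := Ordinal n2.
move=> /(_ (fun x => if x == ord0 then pc_gen R G i else pc_gen R G j)) /=.
move/(@adl_bracket_eq0 R n G [::] i j)/(_ (fun x => (x == i)%:R)) => K.
suff /K/eqP : loc_const G (mem [:: i; j]) (fun x => (x == i)%:R : R).
  by rewrite eqxx oner_eq0.
move=> x y.
have nij : ~~ adj G i j by rewrite Gc -!val_eqE /= !modn_small //; lia.
have nji : ~~ adj G j i by rewrite adj_sym.
change (x \in [:: i; j] -> y \in [:: i; j] -> adj G x y ->
  (x == i)%:R = (y == i)%:R :> R).
rewrite !inE => /orP[] /eqP -> /orP[] /eqP -> //.
  by rewrite (negbTE nij).
by rewrite (negbTE nji).
Qed.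

Lemma cycles_distinguished p q (G : sgraph 'I_p) (H : sgraph 'I_q) :
  cyclic_graph G ->
  cyclic_graph H ->
  (3 <= q)%N -> (q < p)%N ->
  exists2 s, satisfies (pc_metabelian R H) s
    & ~ satisfies (pc_metabelian R G) s.
Proof.
move=> Gc Hc q3 qp; have [p5|p4] := leqP 5 p.
  exists (Universal (FNot (cycle_formula p))).
    by move=> w /(cycle_formula_leq p5 Hc); rewrite leqNgt qp.
  by move=> /(_ (pc_gen R G)); apply; apply: cycle_formula_holds.
have q3' : q = 3%N by lia.
subst q; exists comm_sentence; first exact: triangle_abelian.
by apply: cycle_nonabelian => //; lia.
Qed.

End Main.

(** Transport to ordinals makes arithmetic modulo the length available. *)
Definition pull_graph (X : finType) (n : nat) (x : 'I_n -> X) (G : sgraph X) :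
    sgraph 'I_n :=
  SGraph (fun i j => adj_sym G (x i) (x j)) (fun i => adj_irrefl G (x i)).

Local Close Scope ring_scope.

Theorem theorem3p6 (R : idomainType)
  (hZ : injective (fun z : int => (z%:~R)%R : R))
  (n m : nat) (hn : 3 <= n) (hm : 3 <= m)
  (X Y : finType) (x : 'I_n -> X) (y : 'I_m -> Y)
  (Cn : sgraph X) (Cm : sgraph Y)
  (hCn : is_cycle_graph x Cn) (hCm : is_cycle_graph y Cm) :
  universally_equivalent (pc_metabelian R Cn) (pc_metabelian R Cm) <-> m = n.
Proof.
case: hCn hCm => xbij xadj [ybij yadj].
have ex := @pc_iso R _ _ (pull_graph x Cn) Cn x xbij (fun _ _ => erefl).
have ey := @pc_iso R _ _ (pull_graph y Cm) Cm y ybij (fun _ _ => erefl).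
split=> [e|mn]; last first.
  (* Both cycles now have the same adjacency on ordinals, so the identity is a graph isomorphism. *)
  subst m; move=> s; rewrite -(ex s) -(ey s).
  have b : bijective (@id 'I_n) by exists id.
  by apply: (pc_iso R b) => i j /=; rewrite xadj yadj.
(* The separating sentence holds for the shorter cycle and fails for the longer one. *)
case: (ltngtP m n) => // [mn|nm].
  have [s hs []] := cycles_distinguished R (G := pull_graph x Cn)
    (H := pull_graph y Cm) xadj yadj hm mn.
  by apply/ex/e/ey.
have [s hs []] := cycles_distinguished R (G := pull_graph y Cm)
  (H := pull_graph x Cn) yadj xadj hn nm.
by apply/ey/e/ex.
Qed.
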